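(* Let $\alpha\in(0,1)$ and let the index set $\mathcal I$ be either $\{1,\dots,n\}$ for some $n\in\mathbb N$ or $\mathbb N=\{1,2,\dots\}$. Let $(p_i)_{i\in\mathcal I}$ be independent random variables taking values in $[0,1]$ such that $\mathbb P(p_i\le t)\le t$ for all $t\in[0,1]$ and all $i\in\mathcal I$. Let $u_\alpha(k)$ be either the linear boundary $$u_\alpha(k)=\sqrt{\frac{-\log\alpha}{2m}}\,k+\sqrt{\frac{-m\log\alpha}{2}}$$ for an arbitrary fixed $m>0$, or the curved boundary $$u_\alpha(k)=1.7\sqrt{k\left(\log\log(2k)+0.72\log\frac{5.2}{\alpha}\right)}.$$ Then $$\mathbb P\Big(\exists k\in\mathcal I:\ \sum_{i=1}^k\Phi^{-1}(1-p_i)\ge u_\alpha(k)\Big)\le\alpha,$$ i.e. the martingale Stouffer test, which rejects the global null when this event occurs, controls the type-I error at level $\alpha$.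
   Context: $\Phi$ denotes the standard Gaussian cumulative distribution function. The condition $\mathbb P(p_i\le t)\le t$ means that each $p_i$ is stochastically larger than a uniform random variable on $[0,1]$ (this is the situation under the global null hypothesis). *)

(* Defs.v *)
From HB Require Import structures.
From mathcomp Require Import all_boot all_order all_algebra finmap.
From mathcomp Require Import all_classical all_reals all_analysis.
Set Implicit Arguments. Unset Strict Implicit. Unset Printing Implicit Defensive.
Import Order.TTheory GRing.Theory Num.Theory.
Local Open Scope classical_set_scope.
Local Open Scope ring_scope.

Definition Phi {R : realType} (x : R) : R :=
  fine (normal_prob 0 1 `]-oo, x]).

(* Quantile function Phi^{-1}(y) = inf {x | y <= Phi x}, extended-real valued:
   Phi^{-1}(1) = +oo, Phi^{-1}(0) = -oo, and for y in (0,1) it is the unique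
   real x with Phi x = y. *)
Definition Phiinv {R : realType} (y : R) : \bar R :=
  ereal_inf [set x%:E | x in [set x : R | y <= Phi x]].

Definition inI (N : option nat) (i : nat) : bool :=
  (1 <= i)%N && (match N with Some n => (i <= n)%N | None => true end).

Definition mutually_independent {d} {T : measurableType d} {R : realType}
  (P : probability T R) (I : nat -> bool) (X : nat -> T -> R) : Prop :=
  forall (J : {fset nat}) (B : nat -> set R),
    (forall j, j \in J -> I j) ->
    (forall j, j \in J -> measurable (B j)) ->
    P [set w | forall j, j \in J -> B j (X j w)] =
    (\prod_(j <- J) P (X j @^-1` B j))%E.

Definition u_lin {R : realType} (alpha m : R) (k : nat) : R :=
  Num.sqrt (- ln alpha / (2 * m)) * k%:R + Num.sqrt (- (m * ln alpha) / 2).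

Definition u_curved {R : realType} (alpha : R) (k : nat) : R :=
  (17 / 10) * Num.sqrt (k%:R * (ln (ln (2 * k%:R)) + (72 / 100) * ln ((52 / 10) / alpha))).

(* Main.v *)
(* For l > 0 set Z_i := Phi^-1(1 - p_i). Super-uniformity of p_i says that Z_i is
   stochastically dominated by a standard normal, so E[exp(l Z_i)] <= exp(l^2/2)
   and prod_(i <= k) exp(l Z_i - l^2/2) is a nonnegative supermartingale; by
   Ville's inequality it ever reaches c with probability at most 1/c. Hence a
   boundary u with l u(k) - l^2 k/2 >= ln c for all k is crossed with probability
   at most 1/c. The linear boundary gives equality for l = 2 sqrt(-ln alpha/(2m))
   and c = 1/alpha.
   The curved boundary is stitched from one such line per dyadic epoch
   2^j <= k < 2^(j+1), with error budget alpha w_j, where w_j is proportional to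
   (j+1)^(-7/5). The constants 1.7, 0.72 and 5.2 leave just enough room:
   1.7^2 * 2 sqrt 2/(3 + 2 sqrt 2) >= 7/5, 7/5 * 0.72 >= 1, and
   sum_n n^(-7/5) <= 3.13 <= ((ln 2) * 5.2^0.72)^(7/5). *)
Require Import Defs.
From HB Require Import structures.
From mathcomp Require Import all_boot all_order all_algebra finmap.
From mathcomp Require Import all_classical all_reals all_analysis.
From mathcomp Require Import measurable_realfun ring lra zify.
Import Order.TTheory GRing.Theory Num.Theory.
Local Open Scope classical_set_scope.
Local Open Scope ring_scope.

(** * Independence and Ville's inequality *)

(** The law of the pair agrees with the product law on rectangles, hence everywhere, and Tonelli
    separates the factors. The target spaces are arbitrary so that [X] can later stand for the whole
    past. *)
Lemma ge0_integral_indep_mul (R : realType) (d d1 d2 : measure_display)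
  (T : measurableType d) (T1 : measurableType d1) (T2 : measurableType d2)
  (P : probability T R) (X : {mfun T >-> T1}) (Y : {mfun T >-> T2})
  (f : T1 -> \bar R) (g : T2 -> \bar R) :
  (forall A B, measurable A -> measurable B ->
    P (X @^-1` A `&` Y @^-1` B) = (P (X @^-1` A) * P (Y @^-1` B))%E) ->
  measurable_fun setT f -> measurable_fun setT g ->
  (forall x, (0 <= f x)%E) -> (forall y, (0 <= g y)%E) ->
  (\int[P]_w (f (X w) * g (Y w)) = \int[P]_w f (X w) * \int[P]_w g (Y w))%E.
Proof.
move=> XY mf mg f0 g0.
have mXY : measurable_fun setT (fun w => (X w, Y w)) by exact: measurable_fun_pair.
pose XYm := isMeasurableFun.Build _ _ _ _ _ mXY.
pose Z : {mfun T >-> (T1 * T2)%type} := HB.pack (fun w => (X w, Y w)) XYm.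
pose h := fun z : T1 * T2 => (f z.1 * g z.2)%E.
have mh : measurable_fun setT h.
  by apply: emeasurable_funM; exact: measurableT_comp.
have h0 z : (0 <= h z)%E by exact: mule_ge0.
have ZE A : measurable A ->
    (distribution P X \x distribution P Y)%E A = distribution P Z A.
  apply: (@product_measure_unique _ _ _ _ _ (distribution P X)
    (distribution P Y) (distribution P Z)) => C D mC mD.
  by rewrite -XY.
transitivity (\int[distribution P Z]_z h z)%E.
  by rewrite ge0_integral_distribution.
rewrite -(@eq_measure_integral _ _ _ _ (distribution P Z)
  (distribution P X \x distribution P Y)%E); last first.
  by move=> A mA _; exact: ZE.
rewrite (fubini_tonelli1 _ mh h0).
have gE : (\int[distribution P Y]_y g y = \int[P]_w g (Y w))%E.
  by rewrite ge0_integral_distribution.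
have fE : (\int[distribution P X]_x f x = \int[P]_w f (X w))%E.
  by rewrite ge0_integral_distribution.
rewrite /fubini_F /h /=.
under eq_integral do rewrite ge0_integralZl// gE muleC.
rewrite ge0_integralZl//; last by apply: integral_ge0 => w _; exact: g0.
by rewrite muleC fE.
Qed.

(** Dynkin's pi-lambda argument: for fixed [E], the sets [A] satisfying the product formula form a
    Dynkin system containing the pi-system [G]. *)
Lemma indep_sigma_algebra (R : realType) (d : measure_display)
  (T : measurableType d) (P : probability T R) (G : set (set T)) (E : set T) :
  G `<=` measurable -> setI_closed G -> measurable E ->
  (forall A, G A -> P (A `&` E) = (P A * P E)%E) ->
  forall A, <<s G >> A -> P (A `&` E) = (P A * P E)%E.
Proof.
move=> mG GI mE GE.
have sm : <<s G >> `<=` measurable.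
  by apply: smallest_sub => //; exact: sigma_algebra_measurable.
apply: (@dynkin_induction _ (g_sigma_algebraType G) G
  (fun A => P (A `&` E) = (P A * P E)%E)) => //.
- by rewrite setTI probability_setT mul1e.
- move=> S /sm mS IS; have {}IS : P ((S : set T) `&` E) = (P S * P E)%E := IS.
  rewrite setIC -setDE measureD//; last by rewrite ltey_eq fin_num_measure.
  rewrite [X in (_ - X)%E](_ : _ = P S * P E)%E; last by rewrite setIC; exact: IS.
  rewrite probability_setC// muleBl ?mul1e ?fin_num_measure//.
- move=> F mF tF IF.
  have mF' n : measurable (F n : set T) by apply: sm; exact: mF.
  rewrite setI_bigcupl !measure_bigcup//; last 2 first.
  + by move=> n _; exact: measurableI.
  + exact: trivIset_setIr.
  rewrite muleC -(@fineK _ (P E)) ?fin_num_measure// -nneseriesZl//.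
  by apply: eq_eseriesr => n _; rewrite fineK ?fin_num_measure// muleC; exact: IF.
Qed.

Definition crossed {R : realType} {T : Type} (M : nat -> T -> \bar R) (c : R)
    (n : nat) : set T :=
  [set w | exists2 k, (0 < k <= n)%N & (c%:E <= M k w)%E].

Lemma crossed0 (R : realType) (T : Type) (M : nat -> T -> \bar R) (c : R) :
  crossed M c 0 = set0.
Proof. by apply/seteqP; split=> w //= -[[|k]]. Qed.

Lemma crossedS (R : realType) (T : Type) (M : nat -> T -> \bar R) (c : R) n :
  crossed M c n.+1 = crossed M c n `|` [set w | (c%:E <= M n.+1 w)%E].
Proof.
apply/seteqP; split=> w /=.
- move=> [k /andP[k0]]; rewrite leq_eqVlt ltnS => /predU1P[->|kn] cM; first by right.
  by left; exists k => //; rewrite k0.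
- case=> [[k /andP[k0 kn] cM]|cM]; last by exists n.+1 => //; rewrite leqnn.
  by exists k => //; rewrite k0 leqW.
Qed.

Lemma measurable_crossed (R : realType) (d : measure_display)
  (T : measurableType d) (M : nat -> T -> \bar R) (c : R) n :
  (forall k, (k <= n)%N -> measurable_fun setT (M k)) ->
  measurable (crossed M c n).
Proof.
elim: n => [|n IH] mM; first by rewrite crossed0.
rewrite crossedS; apply: measurableU.
  by apply: IH => k kn; apply: mM; exact: leqW.
rewrite -[X in measurable X]setTI; apply: measurable_lee => //; exact: mM.
Qed.

(** Ville's inequality up to time [N]. The supermartingale property is integrated over the events of
    no crossing so far, the form in which independence will supply it. *)
Lemma supermartingale_crossed (R : realType) (d : measure_display)
  (T : measurableType d) (P : probability T R) (M : nat -> T -> \bar R)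
  (c : R) (N : nat) :
  0 <= c ->
  (forall n, (n <= N)%N -> measurable_fun setT (M n)) ->
  (forall n w, (0 <= M n w)%E) ->
  (\int[P]_w M 0%N w <= 1)%E ->
  (forall n, (n < N)%N ->
    (\int[P]_(w in ~` crossed M c n) M n.+1 w <=
     \int[P]_(w in ~` crossed M c n) M n w)%E) ->
  (c%:E * P (crossed M c N) <= 1)%E.
Proof.
move=> c0 mM M0 M01 Mdec.
have mC n : (n <= N)%N -> measurable (crossed M c n).
  by move=> nN; apply: measurable_crossed => k kn; apply: mM; exact: leq_trans nN.
(* The left-hand side does not increase with [n]: mass of the process that crosses is traded for [c]
   times the probability of crossing. *)
suff H n : (n <= N)%N -> (\int[P]_(w in ~` crossed M c n) M n w +
    c%:E * P (crossed M c n) <= 1)%E.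
  apply: le_trans (H N (leqnn N)).
  by rewrite leeDr// integral_ge0.
elim: n => [_|n IH nN].
  by rewrite crossed0 setC0 measure0 mule0 adde0.
apply: le_trans (IH (ltnW nN)).
have mCn := mC _ (ltnW nN); have mCS := mC _ nN; have mMS := mM _ nN.
(* [D] is the event that the first crossing occurs at time [n.+1]; the integral of [M n.+1] over it
   is at least [c%:E * P D]. *)
set D := ~` crossed M c n `&` [set w | (c%:E <= M n.+1 w)%E].
have mL : measurable [set w | (c%:E <= M n.+1 w)%E].
  by rewrite -[X in measurable X]setTI; exact: measurable_lee.
have mD : measurable D by apply: measurableI => //; exact: measurableC.
have CE : crossed M c n.+1 = crossed M c n `|` D.
  by rewrite crossedS /D setUIr setUCr setTI.
have CD : ~` crossed M c n = ~` crossed M c n.+1 `|` D.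
  rewrite crossedS setCU /D -setIUr setUC setUCr setIT //.
rewrite CE measureU//; last by rewrite /D setIA setICr set0I.
rewrite -CE ge0_muleDr// addeA addeAC; apply: leeD => //.
apply: le_trans (Mdec _ nN).
rewrite CD ge0_integral_setU//; last 3 first.
- exact: measurableC.
- exact: measurable_funTS.
- apply/disj_setPS => w [] /=; rewrite CE => nC DW; apply: nC; by right.
apply: leeD => //.
rewrite -integral_cst//; apply: ge0_le_integral => //.
- by apply: measurable_funTS.
- by move=> w [].
Qed.

Definition cylinder {R : realType} {T : Type} (X : nat -> T -> R) (n : nat)
    (B : nat -> set R) : set T :=
  [set w | forall j, (0 < j <= n)%N -> B j (X j w)].

(** A pi-system generating the sigma-algebra of [X 1], ..., [X n]. *)
Definition cylinders {R : realType} {T : Type} (X : nat -> T -> R) (n : nat)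
    : set (set T) :=
  [set cylinder X n B | B in [set B : nat -> set R | forall j, measurable (B j)]].

Lemma measurable_cylinder (R : realType) (d : measure_display)
  (T : measurableType d) (X : nat -> T -> R) n B :
  (forall j, (0 < j <= n)%N -> measurable_fun setT (X j)) ->
  (forall j, measurable (B j)) -> measurable (cylinder X n B).
Proof.
move=> mX mB.
rewrite (_ : cylinder X n B =
  \bigcap_j (if (0 < j <= n)%N then X j @^-1` B j else setT)).
  apply: bigcapT_measurable => j; case: ifPn => // jn.
  by rewrite -[X in measurable X]setTI; exact: mX.
apply/seteqP; split=> w /= H j; first by move=> _; case: ifPn => // jn; exact: H.
by move=> jn; have := H j I; rewrite jn.
Qed.

Lemma setI_closed_cylinders (R : realType) (T : Type) (X : nat -> T -> R) n :
  setI_closed (cylinders X n).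
Proof.
move=> _ _ [B mB <-] [C mC <-]; exists (fun j => B j `&` C j).
  by move=> j; apply: measurableI; [exact: mB|exact: mC].
apply/seteqP; split=> w /=.
  by move=> H; split=> j jn; have [] := H j jn.
by move=> [HB HC] j jn; split; [exact: HB|exact: HC].
Qed.

(** The product formulas for the indices up to [n] and up to [n.+1] differ exactly by the factor of
    [X n.+1]. *)
Lemma cylinder_indep (R : realType) (d : measure_display) (T : measurableType d)
  (P : probability T R) (I : nat -> bool) (X : nat -> T -> R) n (E : set R) :
  mutually_independent P I X ->
  (forall j, (0 < j <= n.+1)%N -> I j) ->
  measurable E ->
  forall A, cylinders X n A ->
  P (A `&` X n.+1 @^-1` E) = (P A * P (X n.+1 @^-1` E))%E.
Proof.
move=> indX In mE _ [B mB <-].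
pose J : {fset nat} := [fset j in iota 1 n]%fset.
have memJ j : (j \in J) = (0 < j <= n)%N by rewrite !inE mem_iota add1n ltnS.
have nJ : n.+1 \notin J by rewrite memJ ltnn.
pose C j := if j == n.+1 then E else B j.
have -> : cylinder X n B = [set w | forall j, j \in J -> B j (X j w)].
  by apply/seteqP; split=> w H j jJ; apply: H; move: jJ; rewrite memJ.
rewrite indX //; last by move=> j; rewrite memJ => /andP[? ?]; apply: In; lia.
have -> : [set w | forall j, j \in J -> B j (X j w)] `&` X n.+1 @^-1` E =
    [set w | forall j, j \in (n.+1 |` J)%fset -> C j (X j w)].
  apply/seteqP; split=> w /=.
  - move=> [H HE] j; rewrite !inE /C => /orP[/eqP->|jJ]; first by rewrite eqxx.
    case: eqP => [->//|_]; apply: H.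
    by rewrite !inE.
  - move=> H; split=> [j jJ|].
      have := H j; rewrite /C inE jJ orbT => /(_ isT).
      by case: eqP jJ => // ->; rewrite (negbTE nJ).
    by have := H n.+1; rewrite /C !inE !eqxx => /(_ isT).
rewrite indX; last 2 first.
- move=> j; rewrite inE memJ => /orP[|/andP[? ?]]; last by apply: In; lia.
  by rewrite inE => /eqP ->; apply: In; rewrite leqnn.
- by move=> j _; rewrite /C; case: ifP => _; [exact: mE|exact: mB].
rewrite big_fsetU1 //= muleC /C eqxx; congr (_ * _)%E.
rewrite big_seq [RHS]big_seq; apply: eq_bigr => j jJ.
by case: eqP jJ => // ->; rewrite (negbTE nJ).
Qed.

(** The identity map from [T] to [T] with the sigma-algebra generated by the cylinders is a random
    variable carrying the whole past. Its independence of [X n.+1] extends from cylinders by the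
    Dynkin argument. *)
Lemma ge0_integral_cylinder_mul (R : realType) (d : measure_display)
  (T : measurableType d) (P : probability T R) (I : nat -> bool)
  (X : nat -> T -> R) n (F : T -> \bar R) (g : R -> \bar R) :
  mutually_independent P I X ->
  (forall j, (0 < j <= n.+1)%N -> I j) ->
  (forall j, (0 < j <= n.+1)%N -> measurable_fun setT (X j)) ->
  measurable_fun (setT : set (g_sigma_algebraType (cylinders X n))) F ->
  measurable_fun setT g ->
  (forall w, (0 <= F w)%E) -> (forall x, (0 <= g x)%E) ->
  (\int[P]_w (F w * g (X n.+1 w)) = \int[P]_w F w * \int[P]_w g (X n.+1 w))%E.
Proof.
move=> indX In mX mF mg F0 g0.
have cm : cylinders X n `<=` measurable.
  move=> _ [B mB <-]; apply: measurable_cylinder => // j /andP[? ?].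
  by apply: mX; lia.
have sm : <<s cylinders X n >> `<=` measurable.
  by apply: smallest_sub => //; exact: sigma_algebra_measurable.
have mid : measurable_fun (setT : set T)
    (id : T -> g_sigma_algebraType (cylinders X n)).
  by move=> _ A mA; rewrite setTI; exact: sm.
pose idm := isMeasurableFun.Build _ _ _ _ _ mid.
pose Y : {mfun T >-> g_sigma_algebraType (cylinders X n)} := HB.pack id idm.
have mXS : measurable_fun setT (X n.+1) by apply: mX; rewrite leqnn.
pose Xm := isMeasurableFun.Build _ _ _ _ _ mXS.
pose Z : {mfun T >-> R} := HB.pack (X n.+1) Xm.
apply: (@ge0_integral_indep_mul _ _ _ _ _ _ _ P Y Z) => // A B mA mB.
apply: (@indep_sigma_algebra _ _ _ _ _ _ cm) => //.
- exact: setI_closed_cylinders.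
- by rewrite -[X in measurable X]setTI; exact (mXS measurableT B mB).
- exact: (@cylinder_indep _ _ _ P I X n B indX In mB).
Qed.

(* The values of [f i] are extended reals because exp(l Phi^-1(1 - p)) is +oo at
   p = 0, and p = 0 is only a null event. *)
Lemma ville_product (R : realType) (d : measure_display) (T : measurableType d)
  (P : probability T R) (N : option nat) (X : nat -> T -> R)
  (f : nat -> R -> \bar R) (c : R) :
  0 < c ->
  mutually_independent P (inI N) X ->
  (forall i, inI N i -> measurable_fun setT (X i)) ->
  (forall i, measurable_fun setT (f i)) ->
  (forall i x, (0 <= f i x)%E) ->
  (forall i, inI N i -> (\int[P]_w f i (X i w) <= 1)%E) ->
  let E := [set w | exists2 k, inI N k &
    (c%:E <= \prod_(1 <= i < k.+1) f i (X i w))%E] in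
  measurable E /\ (P E <= c^-1%:E)%E.
Proof.
move=> c0 indX mX mf f0 f1 E.
pose M k w := (\prod_(1 <= i < k.+1) f i (X i w))%E.
pose ok n := forall j, (0 < j <= n)%N -> inI N j.
have MS n w : M n.+1 w = (M n w * f n.+1 (X n.+1 w))%E.
  by rewrite /M big_nat_recr.
have M00 w : M 0%N w = 1%E by rewrite /M big_nil.
have M0 n w : (0 <= M n w)%E by apply: prode_ge0 => i _; exact: f0.
have mM n : ok n -> measurable_fun setT (M n).
  elim: n => [_|n IH okn]; first by rewrite (funext M00).
  rewrite (funext (MS n)); apply: emeasurable_funM.
    by apply: IH => j /andP[? ?]; apply: okn; lia.
  apply: measurableT_comp; first exact: mf.
  by apply: mX; apply: okn; rewrite leqnn.
(* Adaptedness: an event about one coordinate is a cylinder with [setT] at all other places. *)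
have mgM n k : (k <= n)%N ->
    measurable_fun (setT : set (g_sigma_algebraType (cylinders X n))) (M k).
  elim: k => [_|k IH kn]; first by rewrite (funext M00).
  rewrite (funext (MS k)); apply: emeasurable_funM; first by apply: IH; lia.
  apply: measurableT_comp; first exact: mf.
  move=> _ B mB; rewrite setTI; apply: sub_sigma_algebra.
  exists (fun j => if j == k.+1 then B else setT).
    by move=> j; case: ifP.
  apply/seteqP; split=> w /=.
    by move=> /(_ k.+1); rewrite eqxx; apply; lia.
  by move=> Bw j _; case: eqP => // ->.
have PC n : ok n -> measurable (crossed M c n) /\ (P (crossed M c n) <= c^-1%:E)%E.
  move=> okn.
  have oks k : (k <= n)%N -> ok k by move=> kn j /andP[? ?]; apply: okn; lia.
  split; first by apply: measurable_crossed => k /oks; exact: mM.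
  rewrite -[leLHS]mul1e -(@mulVf _ c) ?gt_eqF// EFinM -muleA.
  rewrite -[leRHS]mule1; apply: lee_wpmul2l; first by rewrite lee_fin invr_ge0 ltW.
  apply: supermartingale_crossed => //.
  - exact: ltW.
  - by move=> k /oks; exact: mM.
  - under eq_integral do rewrite M00.
    by rewrite integral_cst// mul1e probability_le1.
  move=> k kn.
  have mCk : measurable (~` crossed M c k).
    by apply/measurableC/measurable_crossed => j jk; apply/mM/oks; lia.
  have mgCk : measurable (~` crossed M c k :
      set (g_sigma_algebraType (cylinders X k))).
    by apply/measurableC/measurable_crossed => j jk; exact: mgM.
  (* Restricted to the event of no crossing, [M k] is still a function of the past, so the next
     factor splits off, with mean at most 1. *)
  rewrite integral_mkcond [leRHS]integral_mkcond.
  have Ck0 w : (0 <= (M k \_ (~` crossed M c k)) w)%E by apply: erestrict_ge0.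
  rewrite (eq_integral (fun w => (M k \_ (~` crossed M c k)) w *
    f k.+1 (X k.+1 w))%E); last first.
    by move=> w _; rewrite !patchE; case: ifP => _; rewrite ?MS// mul0e.
  have mf1 : measurable_fun setT (fun w => f k.+1 (X k.+1 w)).
    by apply: measurableT_comp; [exact: mf|apply/mX/okn; lia].
  rewrite (@ge0_integral_cylinder_mul _ _ _ _ _ _ _ _ _ indX) //.
  + rewrite -[leRHS]mule1; apply: lee_wpmul2l; first exact: integral_ge0.
    by apply/f1/okn; lia.
  + by move=> j jk; apply: okn; lia.
  + by move=> j jk; apply/mX/okn; lia.
  + by apply/(measurable_restrictT _ mgCk)/measurable_funTS; exact: mgM.
(* For a finite index set [E] is itself a crossing event; otherwise it is the increasing union of
   all of them, and continuity from below passes the bound to the limit. *)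
case: N => [n|] in E indX mX f1 ok mM PC *.
  have -> : E = crossed M c n by apply/seteqP; split.
  exact: PC.
have okT n : ok n by move=> j /andP[j0 _]; rewrite /inI j0.
have EE : E = \bigcup_n crossed M c n.
  apply/seteqP; split=> w /=.
    by case=> k; rewrite /inI andbT => k1 cM; exists k => //; exists k => //; rewrite k1/=.
  by case=> n _ [k /andP[k0 kn] cM]; exists k => //; rewrite /inI k0.
have mE : measurable E.
  by rewrite EE; apply: bigcupT_measurable => n; have [] := PC n (okT n).
split => //.
have cvgC : P (crossed M c n) @[n --> \oo] --> P (\bigcup_n crossed M c n).
  apply: nondecreasing_cvg_mu.
  - by move=> n; have [] := PC n (okT n).
  - by rewrite -EE.
  - move=> m n mn; apply/subsetPset => w [k /andP[k0 km] cM]; exists k => //.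
    by rewrite k0 (leq_trans km).
rewrite EE -(cvg_lim _ cvgC)//; apply: lime_le.
  by apply/cvg_ex; exists (P (\bigcup_n crossed M c n)).
by apply: nearW => n; have [] := PC n (okT n).
Qed.

(** * Layer-cake formula, stochastic domination and densities *)

Definition subgraph {R : realType} {T : Type} (f : T -> \bar R) : set (T * R) :=
  [set z | 0 <= z.2 /\ (z.2%:E < f z.1)%E].

Lemma measurable_subgraph (R : realType) (d : measure_display)
  (T : measurableType d) (f : T -> \bar R) :
  measurable_fun setT f -> measurable (subgraph f : set (T * measurableTypeR R)).
Proof.
move=> mf.
have mf1 : measurable_fun setT (fun z : T * measurableTypeR R => f z.1).
  exact: measurableT_comp.
have m2 : measurable_fun setT (fun z : T * measurableTypeR R => (z.2 : R)%:E).
  by apply/measurable_EFinP; exact: measurable_snd.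
rewrite (_ : subgraph f = [set z | (0%:E <= (z.2 : R)%:E)%E] `&`
  [set z | ((z.2 : R)%:E < f z.1)%E]); last first.
  by apply/seteqP; split=> z /=; rewrite lee_fin.
apply: measurableI; rewrite -[X in measurable X]setTI.
- by apply: measurable_lee.
- by apply: measurable_lte.
Qed.

Lemma lebesgue_xsection_subgraph (R : realType) (T : Type) (f : T -> \bar R) x :
  (0 <= f x)%E -> lebesgue_measure (xsection (subgraph f) x) = f x.
Proof.
move=> f0; case fx : (f x) f0 => [r| |] // r0.
- rewrite (_ : xsection _ _ = `[0, r[%classic).
    rewrite lebesgue_measure_itv /= lte_fin; case: ltP => [_|]; first by rewrite oppr0 adde0.
    by move=> r0'; congr EFin; apply/eqP; rewrite eq_le -!lee_fin r0.
  apply/seteqP; split=> t; rewrite /xsection /= inE /subgraph /= fx in_itv /= lte_fin.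
    by move=> [-> ->].
  by move/andP.
- rewrite (_ : xsection _ _ = `[0, +oo[%classic).
    by rewrite lebesgue_measure_itv/= ltry.
  apply/seteqP; split=> t; rewrite /xsection /= inE /subgraph /= fx in_itv /= ltry andbT.
    by case.
  by [].
Qed.

Lemma ysection_subgraph (R : realType) (T : Type) (f : T -> \bar R) t :
  ysection (subgraph f) t = if 0 <= t then [set x | (t%:E < f x)%E] else set0.
Proof.
rewrite /ysection; case: ifPn => t0; apply/seteqP; split=> x //=; rewrite inE /subgraph /=.
- by case.
- by move=> tf; split.
- by rewrite (negbTE t0) => -[].
Qed.

(** Tonelli for the indicator of the subgraph: its sections over [x] have Lebesgue length [f x], and
    those at height [t >= 0] are the superlevel sets. *)
Lemma layer_cake (R : realType) (d : measure_display) (T : measurableType d)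
  (P : {sigma_finite_measure set T -> \bar R}) (f : T -> \bar R) :
  measurable_fun setT f -> (forall x, (0 <= f x)%E) ->
  (\int[P]_x f x = \int[lebesgue_measure]_t P (ysection (subgraph f) t))%E.
Proof.
move=> mf f0.
have mA := @measurable_subgraph _ _ _ _ mf.
have := @indic_fubini_tonelli _ _ _ _ _ P (@lebesgue_measure R) _ mA.
rewrite indic_fubini_tonelli_FE// indic_fubini_tonelli_GE// => <-.
by apply: eq_integral => x _; rewrite /= lebesgue_xsection_subgraph.
Qed.

(** Stochastic domination across two spaces: the layer-cake integrands are compared at each
    level. *)
Lemma ge0_le_integral_ccdf (R : realType) (d d' : measure_display)
  (T : measurableType d) (T' : measurableType d')
  (P : {sigma_finite_measure set T -> \bar R})
  (Q : {sigma_finite_measure set T' -> \bar R})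
  (f : T -> \bar R) (g : T' -> \bar R) :
  measurable_fun setT f -> measurable_fun setT g ->
  (forall x, (0 <= f x)%E) -> (forall x, (0 <= g x)%E) ->
  (forall t : R, 0 <= t ->
    (P [set x | t%:E < f x] <= Q [set x | t%:E < g x])%E) ->
  (\int[P]_x f x <= \int[Q]_x g x)%E.
Proof.
move=> mf mg f0 g0 PQ.
have mF := @measurable_subgraph _ _ _ _ mf.
have mG := @measurable_subgraph _ _ _ _ mg.
rewrite (@layer_cake _ _ _ P f mf f0) (@layer_cake _ _ _ Q g mg g0); apply: ge0_le_integral => //.
- exact: (measurable_fun_ysection P mF).
- exact: (measurable_fun_ysection Q mG).
- by move=> t _; rewrite !ysection_subgraph; case: ifPn => [/PQ//|]; rewrite !measure0.
Qed.

(** Each layer of [g] has [nu]-measure given by the density; exchanging the integrals over levels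
    and points reassembles [g x] in front of [h x]. *)
Lemma ge0_integral_density (R : realType) (d : measure_display)
  (T : measurableType d) (mu nu : {sigma_finite_measure set T -> \bar R})
  (h : T -> \bar R) (g : T -> \bar R) :
  measurable_fun setT h -> measurable_fun setT g ->
  (forall x, (0 <= h x)%E) -> (forall x, (0 <= g x)%E) ->
  (forall A, measurable A -> nu A = \int[mu]_(x in A) h x)%E ->
  (\int[nu]_x g x = \int[mu]_x (g x * h x))%E.
Proof.
move=> mh mg h0 g0 nuE.
have mG := @measurable_subgraph _ _ _ _ mg.
pose k := fun z : T * measurableTypeR R => ((\1_(subgraph g) z)%:E * h z.1)%E.
have mk : measurable_fun setT k.
  apply: emeasurable_funM; last exact: measurableT_comp.
  exact/measurable_EFinP/measurable_indic.
have k0 z : (0 <= k z)%E by rewrite mule_ge0// lee_fin.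
rewrite (@layer_cake _ _ _ nu g mg g0).
transitivity (\int[lebesgue_measure]_t \int[mu]_x k (x, t))%E.
  apply: eq_integral => t _; rewrite nuE; last exact: measurable_ysection.
  rewrite integral_mkcond; apply: eq_integral => x _.
  by rewrite /k patchE indicE /= mem_ysection; case: ifP; rewrite ?mul1e ?mul0e.
rewrite -(fubini_tonelli k mk k0); apply: eq_integral => x _.
rewrite /k /= -[X in (X * _)%E](@lebesgue_xsection_subgraph _ _ g x)//.
rewrite ge0_integralZr//; last first.
  apply/measurable_EFinP/measurableT_comp; first exact: measurable_indic.
  exact: measurable_pair1.
congr (_ * _)%E.
have := @indic_fubini_tonelli_FE _ _ _ _ _ (@lebesgue_measure R) _ mG.
by move/(congr1 (@^~ x)).
Qed.

(** * Exponential moments of the normal scores *)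

Lemma Phiinv_le (R : realType) (x y : R) :
  x <= y -> (Phiinv x <= Phiinv y)%E.
Proof.
move=> xy; apply: le_ereal_inf => _ [z /= yz <-]; exists z => //=.
exact: le_trans yz.
Qed.

(** By contraposition: if [y <= Phi x], then [x] belongs to the set whose infimum is [Phiinv y]. *)
Lemma lt_Phiinv (R : realType) (x y : R) : (x%:E < Phiinv y)%E -> Phi x < y.
Proof.
rewrite !ltNge => /negP xy; apply/negP => yx; apply: xy.
by apply: ereal_inf_lbound; exists x.
Qed.

(** The function is nonincreasing, so preimages of rays are intervals. *)
Lemma measurable_Phiinv1B (R : realType) :
  measurable_fun setT (fun x : R => Phiinv (1 - x)).
Proof.
apply: (measurability _ (ErealGenOInfty.measurableE R)).
move=> _ [_ [r ->] <-]; rewrite setTI; apply: is_interval_measurable.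
move=> x y _ /= + z /andP[xz zy]; rewrite !in_itv /= !andbT => ry.
by apply: (lt_le_trans ry); apply: Phiinv_le; rewrite lerD2l lerN2.
Qed.

Lemma normal_probE (R : realType) (x : R) :
  normal_prob 0 1 `]-oo, x] = (Phi x)%:E.
Proof. by rewrite /Phi fineK// fin_num_measure. Qed.

Lemma normal_prob_oy (R : realType) (x : R) :
  normal_prob 0 1 `]x, +oo[ = (1 - Phi x)%:E.
Proof.
rewrite -setCitvl; transitivity (1 - normal_prob 0 1 `]-oo, x])%E.
  exact: probability_setC.
by rewrite normal_probE.
Qed.

Lemma Phi_ge0 (R : realType) (x : R) : 0 <= Phi x.
Proof. by rewrite /Phi fine_ge0. Qed.

Lemma Phi_le1 (R : realType) (x : R) : Phi x <= 1.
Proof. by rewrite -lee_fin -normal_probE probability_le1. Qed.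

(* Completing the square: exp(l x) times the N(0,1) density is exp(l^2/2) times
   the N(l,1) density. *)
Lemma normal_mgf (R : realType) (l : R) :
  (\int[normal_prob 0 1]_x (expR (l * x))%:E = (expR (l ^+ 2 / 2))%:E)%E.
Proof.
have mexp : measurable_fun setT (fun x : R => (expR (l * x))%:E).
  apply/measurable_EFinP; exact: measurableT_comp.
rewrite (@ge0_integral_density R _ _ (@lebesgue_measure R) (normal_prob 0 1)
  (fun x => (normal_pdf 0 1 x)%:E)) //; last 2 first.
- by apply/measurable_EFinP; exact: measurable_normal_pdf.
- by move=> x; rewrite lee_fin normal_pdf_ge0.
transitivity (\int[lebesgue_measure]_x
    ((expR (l ^+ 2 / 2))%:E * (normal_pdf l 1 x)%:E))%E.
  apply: eq_integral => x _; rewrite -!EFinM; congr EFin.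
  have pdfE (m : R) : normal_pdf m 1 x = normal_peak 1 * normal_fun m 1 x.
    by rewrite normal_pdfE ?oner_neq0.
  rewrite !pdfE /normal_fun.
  rewrite mulrCA [RHS]mulrCA; congr (_ * _).
  rewrite -!expRD; congr expR.
  by field.
rewrite ge0_integralZl//; first by rewrite integral_normal_pdf mule1.
- by apply/measurable_EFinP; exact: measurable_normal_pdf.
- by move=> x _; rewrite lee_fin normal_pdf_ge0.
Qed.

Lemma measurable_expeR (R : realType) : measurable_fun setT (@expeR R).
Proof.
apply: (measurability _ (ErealGenOInfty.measurableE R)).
move=> _ [_ [r ->] <-]; rewrite setTI.
have [r0|r0] := ltP r 0.
  rewrite (_ : _ @^-1` _ = setT)//; apply/seteqP; split=> x //= _.
  by rewrite in_itv /= andbT (lt_le_trans _ (expeR_ge0 x))// lte_fin.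
have [y yr] := @expeR_total R r%:E r0.
rewrite (_ : _ @^-1` _ = `]y, +oo[%classic); first exact: emeasurable_itv.
by apply/seteqP; split=> x /=; rewrite !in_itv /= !andbT -yr lte_expeR.
Qed.

(** The normal score of [p] has upper tails below those of a standard normal, so its exponential
    moment is dominated by the normal one. *)
Lemma mgf_Phiinv_le (R : realType) (d : measure_display) (T : measurableType d)
  (P : probability T R) (p : T -> R) (l : R) :
  0 < l ->
  measurable_fun setT p ->
  (forall t : R, 0 <= t <= 1 -> (P [set w | (p w <= t)%R] <= t%:E)%E) ->
  (\int[P]_w expeR (l%:E * Phiinv (1 - p w)) <= (expR (l ^+ 2 / 2))%:E)%E.
Proof.
move=> l0 mp Pp; rewrite -normal_mgf.
have mZ : measurable_fun setT (fun w => Phiinv (1 - p w)).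
  exact: (measurableT_comp (measurable_Phiinv1B R)).
apply: ge0_le_integral_ccdf.
- apply: measurableT_comp; first exact: measurable_expeR.
  exact: measurable_funeM.
- apply/measurable_EFinP; exact: measurableT_comp.
- by move=> w; exact: expeR_ge0.
- by move=> x; rewrite lee_fin expR_ge0.
(* Level 0 is separate because [ln t] is used below; there the normal side has full probability. *)
move=> t; rewrite le_eqVlt => /predU1P[<-|t0].
  rewrite [X in (_ <= normal_prob _ _ X)%E](_ : _ = setT); last first.
    by apply/seteqP; split=> x //= _; rewrite lte_fin expR_gt0.
  rewrite probability_setT; apply: probability_le1.
  rewrite -[X in measurable X]setTI; apply: measurable_lte => //.
  by apply: measurableT_comp; [exact: measurable_expeR|exact: measurable_funeM].
pose x := ln t / l.
have tx : t = expR (l * x) by rewrite /x mulrC divfK ?gt_eqF// lnK.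
rewrite [X in (_ <= normal_prob _ _ X)%E](_ : _ = `]x, +oo[%classic); last first.
  apply/seteqP; split=> y /=;
  by rewrite in_itv /= andbT lte_fin tx ltr_expR ltr_pM2l.
rewrite normal_prob_oy.
(* A score above [x] forces [p w < 1 - Phi x], and super-uniformity at this level gives the normal
   tail. *)
apply: (@le_trans _ _ (P [set w | (p w <= 1 - Phi x)%R])); last first.
  by apply: Pp; rewrite subr_ge0 Phi_le1 lerBlDr lerDl Phi_ge0.
apply: le_measure; rewrite ?inE.
- rewrite -[X in measurable X]setTI; apply: measurable_lte => //.
  by apply: measurableT_comp; [exact: measurable_expeR|exact: measurable_funeM].
- rewrite -[X in measurable X]setTI; exact: measurable_fun_le.
move=> w /=; rewrite tx -[X in (X < _)%E]/(expeR (l * x)%:E) lte_expeR EFinM.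
rewrite lte_pmul2l// => /lt_Phiinv; lra.
Qed.

(* No definedness condition is needed: the library's -oo + +oo = -oo is preserved
   by multiplication by r > 0. It also agrees with 0 * +oo = 0 under [expeR], so
   the sums in the test statistic match products of exponentials everywhere. *)
Lemma gt0_fin_muleDr (R : realType) (r : R) (x y : \bar R) :
  0 < r -> (r%:E * (x + y) = r%:E * x + r%:E * y)%E.
Proof.
move=> r0; have rE : (0 < r%:E)%E by rewrite lte_fin.
have ry := gt0_muley rE; have rNy := gt0_muleNy rE.
case: x => [x| |]; case: y => [y| |]; rewrite ?ry ?rNy //=.
by rewrite -EFinD -!EFinM mulrDr.
Qed.

Lemma expeR_sum (R : realType) (l : R) (z : nat -> \bar R) (k : nat) :
  0 < l ->
  (\prod_(1 <= i < k.+1) (expeR (l%:E * z i) * (expR (- (l ^+ 2 / 2)))%:E) =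
   expeR (l%:E * \sum_(1 <= i < k.+1) z i) * (expR (- (l ^+ 2 / 2) * k%:R))%:E)%E.
Proof.
move=> l0; elim: k => [|k IH].
  by rewrite !big_nil mule0 mulr0 /= expR0 mule1.
rewrite big_nat_recr//= IH [in RHS]big_nat_recr//= gt0_fin_muleDr// expeRD.
have -> : - (l ^+ 2 / 2) * k.+1%:R = - (l ^+ 2 / 2) * k%:R + - (l ^+ 2 / 2).
  by rewrite -(natr1 k) mulrDr mulr1.
rewrite expRD EFinM -!muleA; congr (_ * _)%E.
by rewrite muleCA; congr (_ * _)%E; rewrite muleC.
Qed.

(** * Line crossings of the Stouffer statistic *)

Definition stouffer {R : realType} {T : Type} (p : nat -> T -> R) (k : nat) (w : T)
    : \bar R :=
  (\sum_(1 <= i < k.+1) Phiinv (1 - p i w))%E.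

Lemma measurable_stouffer (R : realType) (d : measure_display)
  (T : measurableType d) (N : option nat) (p : nat -> T -> R) (k : nat) :
  (forall i, inI N i -> measurable_fun setT (p i)) -> inI N k ->
  measurable_fun setT (stouffer p k).
Proof.
move=> mp Ik.
(* Only the [p i] inside the index set are known to be measurable; padding with 0 changes nothing,
   since every [i] from 1 to [k] is in the index set when [k] is. *)
rewrite (_ : stouffer p k = fun w => (\sum_(1 <= i < k.+1)
   if inI N i then Phiinv (1 - p i w) else 0)%E).
  apply: emeasurable_sum => i; case Ii : (inI N i); last exact: measurable_cst.
  have mpi := mp i Ii.
  exact: (measurableT_comp (measurable_Phiinv1B R)).
apply/funext => w; apply: eq_big_nat => i; rewrite ltnS => /andP[i1 ik].
rewrite ifT//; move: Ik; rewrite /inI i1; case: N {mp} => //= n /andP[_].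
exact: leq_trans.
Qed.

(** [E] is the event that the exponential supermartingale of slope [l] reaches [c]. Leaving [x] free
    lets this one event serve every boundary lying above the line, even if only for some [k]. *)
Lemma stouffer_line (R : realType) (d : measure_display) (T : measurableType d)
  (P : probability T R) (N : option nat) (p : nat -> T -> R) (l c : R) :
  0 < l -> 0 < c ->
  (forall i, inI N i -> measurable_fun setT (p i)) ->
  (forall i, inI N i -> forall t : R, 0 <= t <= 1 ->
     (P [set w | (p i w <= t)%R] <= t%:E)%E) ->
  mutually_independent P (inI N) p ->
  exists E : set T, [/\ measurable E, (P E <= c^-1%:E)%E &
    forall w k x, inI N k -> (x%:E <= stouffer p k w)%E ->
      ln c <= l * x - l ^+ 2 / 2 * k%:R -> E w].
Proof.
move=> l0 c0 mp Pp indp.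
pose f (i : nat) (x : R) : \bar R :=
  (expeR (l%:E * Phiinv (1 - x)) * (expR (- (l ^+ 2 / 2)))%:E)%E.
have me : measurable_fun setT (fun x : R => expeR (l%:E * Phiinv (1 - x))%E).
  apply: measurableT_comp; first exact: measurable_expeR.
  apply: measurable_funeM; exact: measurable_Phiinv1B.
have [] := @ville_product R d T P N p f c c0 indp mp.
- by move=> i; apply: emeasurable_funM.
- by move=> i x; rewrite mule_ge0 ?expeR_ge0// lee_fin expR_ge0.
- move=> i Ii; rewrite ge0_integralZr//; last 2 first.
  + by apply: (measurableT_comp me); exact: mp.
  + by move=> w _; exact: expeR_ge0.
  rewrite (_ : 1%E = ((expR (l ^+ 2 / 2))%:E * (expR (- (l ^+ 2 / 2)))%:E)%E); last first.
    by rewrite -EFinM -expRD subrr expR0.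
  apply: lee_wpmul2r; first by rewrite lee_fin expR_ge0.
  by apply: mgf_Phiinv_le => //; [exact: mp|exact: Pp].
set E := [set w | _] => mE PE; exists E; split => // w k x Ik xS clx.
exists k => //; rewrite expeR_sum// -/(stouffer p k w).
apply: (@le_trans _ _ (expeR (l%:E * x%:E) * (expR (- (l ^+ 2 / 2) * k%:R))%:E)%E).
  rewrite -EFinM /= -?EFinM -expRD lee_fin -[leLHS]lnK// ler_expR.
  by rewrite mulNr.
apply: lee_wpmul2r; first by rewrite lee_fin expR_ge0.
by rewrite lee_expeR lee_pmul2l.
Qed.

Lemma stouffer_linear_boundary (R : realType) (alpha m : R) (k : nat) :
  0 < alpha < 1 -> 0 < m ->
  let l := 2 * Num.sqrt (- ln alpha / (2 * m)) in
  0 < l /\ ln alpha^-1 <= l * u_lin alpha m k - l ^+ 2 / 2 * k%:R.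
Proof.
move=> /andP[a0 a1] m0 l.
have L0 : 0 < - ln alpha by rewrite oppr_gt0 ln_lt0// a0.
have x0 : 0 < - ln alpha / (2 * m) by rewrite divr_gt0// mulr_gt0.
split; first by rewrite mulr_gt0// sqrtr_gt0.
rewrite /u_lin lnV ?posrE// /l.
set a := Num.sqrt _; set b := Num.sqrt _.
have ab : a * b = - ln alpha / 2.
  rewrite /a /b -sqrtrM ?ltW//.
  rewrite (_ : _ / _ * _ = (- ln alpha / 2) ^+ 2).
    by rewrite sqrtr_sqr gtr0_norm// divr_gt0.
  by field; exact: lt0r_neq0.
(* Since [l = 2 * a], the terms linear in [k] cancel. *)
rewrite (_ : _ - _ = 2 * (a * b)); last by field.
by rewrite ab mulrC divfK.
Qed.

(** * Numerical estimates *)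

Lemma ger0_is_derive_ndecr (R : realType) (f df : R -> R) (a b : R) :
  a <= b -> (forall x, a <= x <= b -> is_derive x 1 f (df x)) ->
  (forall x, a <= x <= b -> 0 <= df x) -> f a <= f b.
Proof.
move=> ab fdf df0.
apply: (@ger0_derive1_ndecr R f a b) => //.
- by move=> x; rewrite in_itv /= => /andP[ax xb]; apply: ex_derive; apply: fdf; rewrite !ltW.
- move=> x; rewrite in_itv /= => /andP[ax xb].
  have axb : a <= x <= b by rewrite !ltW.
  by rewrite derive1E (@derive_val _ _ _ _ _ _ _ (fdf x axb)) df0.
- apply: derivable_within_continuous => x; rewrite in_itv /= => axb.
  by apply: ex_derive; exact: fdf.
Qed.

Lemma sinh_ge (R : realType) (y : R) : 0 <= y -> 2 * y <= expR y - expR (- y).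
Proof.
move=> y0.
pose f (x : R) := expR x - expR (- x) - 2 * x.
suff : f 0 <= f y by rewrite /f oppr0 subrr mulr0 subr0 subr_ge0.
apply: (@ger0_is_derive_ndecr R f (fun x => expR x + expR (- x) - 2)) => // x _.
- rewrite /f; apply: is_derive_eq.
  by rewrite mulrN1 opprK /GRing.scale /= mulr1.
- rewrite expRN.
  have := expR_gt0 x; move: (expR x) => e e0.
  rewrite (_ : e + e^-1 - 2 = (e - 1) ^+ 2 / e) ?divr_ge0 ?sqr_ge0 ?ltW//.
  by field; exact: lt0r_neq0.
Qed.

Lemma ln_ratio_ge (R : realType) (t : R) :
  0 <= t < 1 -> 2 * t <= ln (1 + t) - ln (1 - t).
Proof.
move=> /andP[t0 t1].
pose f (x : R) := ln (1 + x) - ln (1 - x) - 2 * x.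
suff : f 0 <= f t by rewrite /f addr0 !subr0 subrr mulr0 subr0 subr_ge0.
apply: (@ger0_is_derive_ndecr R f (fun x => (1 + x)^-1 + (1 - x)^-1 - 2)) => // x
  /andP[x0 xt].
- have p1 : 0 < 1 + x by lra.
  have p2 : 0 < 1 - x by lra.
  have d1 : is_derive (1 + x) 1 (@ln R) (1 + x)^-1 := is_derive1_ln p1.
  have d2 : is_derive (1 - x) 1 (@ln R) (1 - x)^-1 := is_derive1_ln p2.
  rewrite /f; apply: is_derive_eq.
  by rewrite !add0r mul1r !mulr1 mulrN1 opprK /GRing.scale /= mulr1.
- have p1 : 0 < 1 + x by lra.
  have p2 : 0 < 1 - x by lra.
  rewrite (_ : _ - 2 = 2 * x ^+ 2 / ((1 + x) * (1 - x))).
    by apply: divr_ge0; apply: mulr_ge0; rewrite ?sqr_ge0 ?ltW.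
  by field; rewrite !lt0r_neq0.
Qed.

(** One squaring step, with the result rounded down to a simpler fraction [b]. *)
Lemma expR_double_ge (R : realType) (a b x y : R) :
  0 <= a -> a <= expR x -> b <= a * a -> x + x = y -> b <= expR y.
Proof.
by move=> a0 ax ba <-; rewrite expRD; apply: (le_trans ba); rewrite ler_pM.
Qed.

(* From exp(-y) >= 1 - y at y = 0.69/256, squared eight times with rounding down. *)
Lemma ln2_ge (R : realType) : 69 / 100 <= ln 2 :> R.
Proof.
have h0 : 370 / 371 <= expR (- (69 / 100 / 256)) :> R.
  by apply: le_trans (expR_ge1Dx _); lra.
have h1 : 739 / 743 <= expR (- (69 / 100 / 128)) :> R.
  by apply: (@expR_double_ge _ _ _ _ _ _ h0); clear; lra.
have h2 : 737 / 745 <= expR (- (69 / 100 / 64)) :> R.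
  by apply: (@expR_double_ge _ _ _ _ _ _ h1); clear; lra.
have h3 : 733 / 749 <= expR (- (69 / 100 / 32)) :> R.
  by apply: (@expR_double_ge _ _ _ _ _ _ h2); clear; lra.
have h4 : 929 / 970 <= expR (- (69 / 100 / 16)) :> R.
  by apply: (@expR_double_ge _ _ _ _ _ _ h3); clear; lra.
have h5 : 787 / 858 <= expR (- (69 / 100 / 8)) :> R.
  by apply: (@expR_double_ge _ _ _ _ _ _ h4); clear; lra.
have h6 : 175 / 208 <= expR (- (69 / 100 / 4)) :> R.
  by apply: (@expR_double_ge _ _ _ _ _ _ h5); clear; lra.
have h7 : 676 / 955 <= expR (- (69 / 100 / 2)) :> R.
  by apply: (@expR_double_ge _ _ _ _ _ _ h6); clear; lra.
have h8 : 1 / 2 <= expR (- (69 / 100)) :> R.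
  by apply: (@expR_double_ge _ _ _ _ _ _ h7); clear; lra.
rewrite -ler_expR lnK ?posrE// -[leLHS]invrK -expRN.
rewrite -[leRHS]invrK lef_pV2 ?posrE ?expR_gt0 ?invr_gt0//.
by apply: le_trans h8; clear; lra.
Qed.

Lemma natr_mul_ln (R : realType) (n : nat) (x : R) :
  0 < x -> n%:R * ln x = ln (x ^+ n).
Proof. by move=> x0; rewrite lnXn// mulr_natl. Qed.

Lemma stitching_constant_ge (R : realType) :
  ln (313 / 100) <= 7 / 5 * (ln (ln 2) + 72 / 100 * ln (52 / 10)) :> R.
Proof.
have l2 := ln2_ge R.
have lnln2 : ln (69 / 100) <= ln (ln 2) :> R by rewrite ler_ln ?posrE//; lra.
(* Five times the right-hand side of the goal contains [ln (52 / 10)] with coefficient 5.04. The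
   excess 0.04 = 1/25 is replaced by [ln (1068 / 1000)], leaving integer powers to compare. *)
have h1068 : 25 * ln (1068 / 1000) <= ln (52 / 10) :> R.
  by rewrite natr_mul_ln ?ler_ln ?posrE; lra.
have h313 : 5 * ln (313 / 100) <= 7 * ln (69 / 100) + 5 * ln (52 / 10) +
    ln (1068 / 1000) :> R.
  rewrite !natr_mul_ln; try lra.
  rewrite -!lnM ?posrE; try lra.
  by rewrite ler_ln ?posrE; lra.
lra.
Qed.

(* The midpoint rule underestimates the integral of the convex function z^(-7/5)
   over [x - 1/2, x + 1/2]. *)
Lemma power_tail_step (R : realType) (x : R) : 1 <= x ->
  expR (- (7 / 5 * ln x)) <=
  5 / 2 * (expR (- (2 / 5 * ln (x - 1 / 2))) - expR (- (2 / 5 * ln (x + 1 / 2)))).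
Proof.
move=> x1; have x0 : 0 < x by lra.
pose t := (2 * x)^-1.
have tx : x * t = 1 / 2 by rewrite /t; field; exact: lt0r_neq0.
have t0 : 0 < t by rewrite invr_gt0 mulr_gt0.
have t1 : t < 1 by nra.
have -> : x - 1 / 2 = x * (1 - t) by rewrite mulrBr mulr1 tx.
have -> : x + 1 / 2 = x * (1 + t) by rewrite mulrDr mulr1 tx.
have t1p : 0 < 1 - t by lra.
have t2p : 0 < 1 + t by lra.
rewrite !lnM ?posrE//.
set C := ln x; set A := ln (1 - t); set B := ln (1 + t).
have AB : 2 * t <= B - A by apply: ln_ratio_ge; rewrite ltW.
have AB0 : A + B <= 0.
  by rewrite /A /B -lnM ?posrE// ln_le0//; nra.
(* With [y = (B - A) / 5], the two exponentials differ by a common factor, at least 1 times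
   [expR (- (2 / 5 * C))], multiplied by [expR y - expR (- y) >= 2 * y]. Finally
   [5 / 2 * (2 * y) = B - A >= 2 * t], which is [expR (- C)]. *)
have -> : - (7 / 5 * C) = - (2 / 5 * C) + - C by lra.
have -> : - (2 / 5 * (C + A)) = - (2 / 5 * C) + (- (A + B) / 5 + (B - A) / 5) by lra.
have -> : - (2 / 5 * (C + B)) = - (2 / 5 * C) + (- (A + B) / 5 + - ((B - A) / 5)) by lra.
rewrite !expRD -mulrBr -mulrBr mulrCA ler_pM2l ?expR_gt0//.
have -> : expR (- C) = 2 * t.
  by rewrite expRN lnK ?posrE// /t; field; exact: lt0r_neq0.
have y0 : 0 <= (B - A) / 5 by lra.
have sh := sinh_ge _ _ y0.
have e1 : 1 <= expR (- (A + B) / 5) by rewrite -[leLHS](@expR0 R) ler_expR; lra.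
have : (expR ((B - A) / 5) - expR (- ((B - A) / 5))) <=
   expR (- (A + B) / 5) * (expR ((B - A) / 5) - expR (- ((B - A) / 5))).
  by rewrite ler_peMl//; lra.
lra.
Qed.

Lemma power_sum_le (R : realType) (n : nat) :
  \sum_(j < n) expR (- (7 / 5 * ln j.+1%:R)) <= 313 / 100 :> R.
Proof.
case: n => [|n]; first by rewrite big_ord0; lra.
(* [g n] is the integral of z^(-7/5) from n + 3/2 to infinity. The first term of the sum, 1, is kept
   exact and the others telescope. *)
pose g (n : nat) : R := 5 / 2 * expR (- (2 / 5 * ln (n%:R + 3 / 2))).
have g0 : g 0%N <= 213 / 100.
  rewrite /g add0r; suff : expR (- (2 / 5 * ln (3 / 2))) <= 852 / 1000 :> R by lra.
  have p : 0 < 852 / 1000 :> R by lra.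
  rewrite -[leRHS]lnK// ler_expR.
  have : - (2 * ln (3 / 2)) <= 5 * ln (852 / 1000) :> R.
    rewrite !natr_mul_ln; try lra.
    rewrite -lnV ?posrE; last by lra.
    by rewrite ler_ln ?posrE; lra.
  lra.
suff : \sum_(j < n.+1) expR (- (7 / 5 * ln j.+1%:R)) <= 1 + g 0%N - g n :> R.
  have : 0 <= g n by rewrite mulr_ge0 ?expR_ge0//; lra.
  lra.
elim: n => [|n IH].
  rewrite big_ord_recl big_ord0 /= ln1 mulr0 oppr0 expR0; lra.
rewrite big_ord_recr /=.
have := power_tail_step R n.+2%:R.
rewrite ler1n => /(_ isT).
have -> : n.+2%:R - 1 / 2 = n%:R + 3 / 2 :> R by rewrite -(natr1 n.+1) -(natr1 n); lra.
have -> : n.+2%:R + 1 / 2 = n.+1%:R + 3 / 2 :> R by rewrite -(natr1 n.+1); lra.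
rewrite mulrBr -/(g n) -/(g n.+1); move: IH.
lra.
Qed.

(** * Stitching *)

(** The part of log log(2k) + 0.72 log(5.2/alpha) at k = 2^j that depends on neither j nor alpha. *)
Definition stitch_const {R : realType} : R :=
  ln (ln 2) + 72 / 100 * ln (52 / 10).

(** The exponent 7/5 is the coefficient of [q ^+ 2] that one line per epoch can guarantee; the
    constant normalizes the total to at most 1. *)
Definition stitch_weight {R : realType} (j : nat) : R :=
  expR (- (7 / 5 * (ln j.+1%:R + stitch_const))).

Lemma stitch_const_gt0 (R : realType) : 0 < stitch_const :> R.
Proof.
have := stitching_constant_ge R; rewrite -/stitch_const.
have : 0 < ln (313 / 100) :> R by apply: ln_gt0; lra.
lra.
Qed.

Lemma stitch_weight_sum_le1 (R : realType) n :
  \sum_(j < n) stitch_weight j <= 1 :> R.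
Proof.
have -> : \sum_(j < n) stitch_weight j = expR (- (7 / 5 * stitch_const)) *
    \sum_(j < n) expR (- (7 / 5 * ln j.+1%:R)) :> R.
  rewrite mulr_sumr; apply: eq_bigr => j _.
  by rewrite /stitch_weight -expRD; congr expR; lra.
rewrite expRN ler_pdivrMl ?expR_gt0// mulr1.
apply: le_trans (power_sum_le R n) _.
rewrite -[leLHS]lnK ?posrE; last by lra.
by rewrite ler_expR; exact: stitching_constant_ge.
Qed.

(* The slope [l] is chosen so that the right-hand side, concave in [x], takes the
   same value at both ends of the epoch [a, sqrt 2 * a]; here x = sqrt k. *)
Lemma stitch_quadratic (R : realType) (q l a x : R) :
  let s := Num.sqrt 2 in
  0 < a -> a <= x -> x <= s * a -> l = 34 / 10 * q / (a + s * a) ->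
  7 / 5 * q ^+ 2 <= l * (17 / 10 * (x * q)) - l ^+ 2 / 2 * x ^+ 2.
Proof.
move=> s a0 ax xsa lE.
have s0 : 0 < s by rewrite sqrtr_gt0.
have s2 : s ^+ 2 = 2 by rewrite sqr_sqrtr.
(* The last inequality of the proof holds once [s] is at least 210/149, slightly below 1.41. *)
have sl : 141 / 100 <= s.
  by rewrite -(@ler_pXn2r _ 2) ?nnegrE ?ltW// s2; lra.
have d0 : 0 < a + s * a by nra.
have qE : 17 / 10 * q = l * (a + s * a) / 2.
  by rewrite lE; field; exact: lt0r_neq0.
(* The parabola is written as its common value at [a] and [s * a] plus a term that is nonnegative
   between them. *)
have -> : l * (17 / 10 * (x * q)) - l ^+ 2 / 2 * x ^+ 2 =
    l ^+ 2 / 2 * ((x - a) * (s * a - x)) + l ^+ 2 / 2 * (s * a ^+ 2).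
  rewrite (_ : 17 / 10 * (x * q) = x * (17 / 10 * q)); last by lra.
  by rewrite qE; field.
have h1 : 0 <= l ^+ 2 / 2 * ((x - a) * (s * a - x)).
  by rewrite mulr_ge0 ?divr_ge0 ?sqr_ge0// mulr_ge0 ?subr_ge0.
suff h2 : 7 / 5 * q ^+ 2 <= l ^+ 2 / 2 * (s * a ^+ 2) by lra.
have -> : q ^+ 2 = (100 / 289) * (l ^+ 2 * ((1 + s) ^+ 2 * a ^+ 2) / 4).
  rewrite (_ : q = 10 / 17 * (17 / 10 * q)); last by lra.
  by rewrite qE; field.
have -> : (1 + s) ^+ 2 = 3 + 2 * s by rewrite sqrrD s2; lra.
have : 0 <= l ^+ 2 * a ^+ 2 by rewrite mulr_ge0 ?sqr_ge0.
set y := l ^+ 2 * a ^+ 2 => y0.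
rewrite (_ : 7 / 5 * _ = 7 / 5 * (100 / 289) * (3 + 2 * s) / 4 * y); last by rewrite /y; field.
rewrite (_ : _ * (s * _) = s / 2 * y); last by rewrite /y; field.
by apply: ler_wpM2r => //; lra.
Qed.

Lemma stouffer_curved_boundary (R : realType) (alpha : R) (j : nat) :
  0 < alpha < 1 ->
  exists2 l : R, 0 < l & forall k : nat, (2 ^ j <= k < 2 ^ j.+1)%N ->
    ln (alpha * stitch_weight j)^-1 <=
      l * u_curved alpha k - l ^+ 2 / 2 * k%:R.
Proof.
move=> /andP[a0 a1].
have L0 : 0 < - ln alpha by rewrite oppr_gt0 ln_lt0// a0.
have ln2 := ln2_ge R.
have ln20 : 0 < ln 2 :> R by lra.
have C0 := stitch_const_gt0 R.
have lnj : 0 <= ln j.+1%:R :> R by rewrite ln_ge0// ler1n.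
(* The boundary's radicand divided by [k], evaluated at the epoch's start, where [2 * k] is 2^(j+1);
   by monotonicity it is a lower bound throughout the epoch. *)
pose ell : R := ln (j.+1%:R * ln 2) + 72 / 100 * ln (52 / 10 / alpha).
have ellE : ell = ln j.+1%:R + stitch_const - 72 / 100 * ln alpha.
  have p : 0 < 52 / 10 :> R by lra.
  rewrite /ell lnM ?posrE ?ltr0n// ln_div ?posrE//.
  by rewrite /stitch_const; lra.
have ell0 : 0 < ell by rewrite ellE; lra.
pose a : R := Num.sqrt (2 ^+ j).
have pa : 0 < a by rewrite sqrtr_gt0 exprn_gt0.
pose l : R := 34 / 10 * Num.sqrt ell / (a + Num.sqrt 2 * a).
have l0 : 0 < l.
  have p : 0 < 34 / 10 :> R by lra.
  apply: divr_gt0; first by rewrite mulr_gt0// sqrtr_gt0.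
  by rewrite addr_gt0// mulr_gt0// sqrtr_gt0.
exists l => // k /andP[jk kj].
have kj1 : 2 ^+ j <= k%:R :> R by rewrite -natrX ler_nat.
have kj2 : k%:R <= 2 ^+ j.+1 :> R by rewrite -natrX ler_nat ltnW.
have k0 : 0 < k%:R :> R by apply: lt_le_trans kj1; rewrite exprn_gt0.
have ax : a <= Num.sqrt k%:R by rewrite ler_wsqrtr.
have xa : Num.sqrt k%:R <= Num.sqrt 2 * a :> R.
  by rewrite /a -sqrtrM// -exprS ler_wsqrtr.
have h := @stitch_quadratic R (Num.sqrt ell) l a (Num.sqrt k%:R) pa ax xa erefl.
rewrite (sqr_sqrtr (ltW ell0)) (sqr_sqrtr (ltW k0)) in h.
have ellk : ell <= ln (ln (2 * k%:R)) + 72 / 100 * ln (52 / 10 / alpha).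
  rewrite /ell lerD2r.
  have e : j.+1%:R * ln 2 <= ln (2 * k%:R) :> R.
    rewrite natr_mul_ln// ler_ln ?posrE ?exprn_gt0 ?mulr_gt0//.
    by rewrite exprS ler_pM2l.
  have p : 0 < j.+1%:R * ln 2 :> R by rewrite mulr_gt0 ?ltr0n.
  by rewrite ler_ln ?posrE// (lt_le_trans p).
have uk : 17 / 10 * (Num.sqrt k%:R * Num.sqrt ell) <= u_curved alpha k.
  rewrite /u_curved ler_pM2l; last by lra.
  by rewrite -(sqrtrM _ (ltW k0)) ler_wsqrtr// ler_pM2l.
have luk := ler_wpM2l (ltW l0) uk.
rewrite lnV ?posrE ?mulr_gt0 ?expR_gt0// lnM ?posrE ?expR_gt0// expRK.
(* Here 7/5 times 0.72 being at least 1 absorbs [- ln alpha > 0]. *)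
apply: (@le_trans _ _ (7 / 5 * ell)); first by rewrite ellE; lra.
by apply: (le_trans h); rewrite lerD2r.
Qed.

Theorem theorem1 (R : realType) (d : measure_display) (T : measurableType d)
  (P : probability T R) (alpha : R) (N : option nat) (p : nat -> T -> R)
  (u : nat -> R) :
  0 < alpha < 1 ->
  (forall i, inI N i -> measurable_fun setT (p i)) ->
  (forall i, inI N i -> forall w, 0 <= p i w <= 1) ->
  (forall i, inI N i -> forall t : R, 0 <= t <= 1 ->
     (P [set w | (p i w <= t)%R] <= t%:E)%E) ->
  mutually_independent P (inI N) p ->
  ((exists m : R, 0 < m /\ u = u_lin alpha m) \/ u = u_curved alpha) ->
  (P [set w | exists k, inI N k /\
        ((u k)%:E <= \sum_(1 <= i < k.+1) Phiinv (1 - p i w))%E] <= alpha%:E)%E.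
Proof.
move=> alpha01 mp _ Pp indp uE.
have /andP[a0 a1] := alpha01.
set S := [set w | _].
have mS : measurable S.
  rewrite (_ : S = \bigcup_k (if inI N k then
    [set w | ((u k)%:E <= stouffer p k w)%E] else set0)).
    apply: bigcupT_measurable => k; case: ifP => // Ik.
    rewrite -[X in measurable X]setTI; apply: measurable_lee => //.
    exact: measurable_stouffer Ik.
  apply/seteqP; split=> w /=.
    by move=> [k [Ik kS]]; exists k => //; rewrite Ik.
  by move=> [k _]; case: ifP => // Ik kS; exists k.
case: uE => [[m [m0 uE]]|uE].
  (* The slope does not depend on [k]; the index 0 serves only to extract its positivity. *)
  have [l0 _] := stouffer_linear_boundary _ _ _ 0 alpha01 m0.
  have ai0 : 0 < alpha^-1 by rewrite invr_gt0.
  have [E [mE PE HE]] := stouffer_line _ _ _ _ _ _ _ _ l0 ai0 mp Pp indp.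
  rewrite invrK in PE; apply: le_trans PE; apply: le_measure; rewrite ?inE//.
  move=> w [k [Ik kS]]; apply: (HE w k (u k) Ik kS).
  by rewrite uE; have [] := stouffer_linear_boundary _ _ _ k alpha01 m0.
have lines (j : nat) : exists E : set T, [/\ measurable E,
    (P E <= (alpha * stitch_weight j)%:E)%E &
    forall w k, inI N k -> (2 ^ j <= k < 2 ^ j.+1)%N ->
      ((u k)%:E <= stouffer p k w)%E -> E w].
  have [l l0 lu] := stouffer_curved_boundary _ _ j alpha01.
  have w0 : 0 < (alpha * stitch_weight j)^-1 by rewrite invr_gt0 mulr_gt0 ?expR_gt0.
  have [E [mE PE HE]] := stouffer_line _ _ _ _ _ _ _ _ l0 w0 mp Pp indp.
  exists E; split => //; first by rewrite invrK in PE.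
  by move=> w k Ik kj kS; apply: (HE w k (u k) Ik kS); rewrite uE; exact: lu.
have [E HE] := choice lines.
apply: (@le_trans _ _ (\sum_(0 <= j <oo) P (E j))%E).
  apply: measure_sigma_subadditive => //.
    by move=> j; have [] := HE j.
  (* The dyadic epoch containing [k], well defined because indices start at 1. *)
  move=> w [k [Ik kS]]; exists (trunc_log 2 k) => //.
  have [_ _] := HE (trunc_log 2 k); apply; [exact: Ik| |exact: kS].
  by apply: trunc_log_bounds => //; move: Ik; rewrite /inI; case/andP.
apply: lime_le; first exact: is_cvg_nneseries.
apply: nearW => n.
apply: (@le_trans _ _ (\sum_(0 <= j < n) (alpha * stitch_weight j)%:E)%E).
  by apply: lee_sum => j _; have [] := HE j.
rewrite sumEFin lee_fin big_mkord -mulr_sumr -[leRHS]mulr1.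
by rewrite ler_pM2l//; exact: stitch_weight_sum_le1.
Qed.
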